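(* Let $n\ge 1$ be an integer and let $u=(u_1,\ldots,u_n)$ and $v=(v_1,\ldots,v_n)$ be $n$-tuples of real numbers with $u_i\ge 1$ and $v_i\ge 1$ for $i=1,\ldots,n$. Consider the two polynomials $$P(t)=\prod_{i=1}^n(t^2-2u_it+1),\qquad Q(t)=\prod_{i=1}^n(t^2-2v_it+1).$$ Let $x=(x_1,\ldots,x_{2n})$ and $y=(y_1,\ldots,y_{2n})$ be the vectors of the roots (listed with multiplicity) of $P(t)$ and $Q(t)$, respectively. If $v$ is majorized by $u$, then $y$ is power majorized by $x$.
   Context: Majorization: for two $m$-tuples of real numbers $a=(a_1,\ldots,a_m)$ and $b=(b_1,\ldots,b_m)$, $a$ is majorized by $b$ if for each $k=1,\ldots,m-1$ the sum of the $k$ largest entries of $a$ is less than or equal to the sum of the $k$ largest entries of $b$, and $\sum_{i=1}^m a_i=\sum_{i=1}^m b_i$. Power majorization: for two $m$-tuples of positive real numbers $a$ and $b$, $a$ is power majorized by $b$ if $\sum_{i=1}^m a_i^p\le\sum_{i=1}^m b_i^p$ for every real $p\ge 1$, and $\sum_{i=1}^m a_i^p\ge\sum_{i=1}^m b_i^p$ for every real $p$ with $0<p<1$. *)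

(* Defs.v *)
From HB Require Import structures.
From mathcomp Require Import all_boot all_order all_algebra.
From mathcomp Require Import reals exp.

Set Implicit Arguments.
Unset Strict Implicit.
Unset Printing Implicit Defensive.

Import Order.TTheory GRing.Theory Num.Theory.
Local Open Scope ring_scope.

Definition sum_largest (R : realType) (m k : nat) (a : m.-tuple R) : R :=
  \sum_(z <- take k (sort >=%R a)) z.

(* [majorized a b]: a is majorized by b. *)
Definition majorized (R : realType) (m : nat) (a b : m.-tuple R) : Prop :=
  (forall k : nat, (1 <= k <= m.-1)%N -> sum_largest k a <= sum_largest k b) /\
  \sum_(i < m) tnth a i = \sum_(i < m) tnth b i.

(* [power_majorized a b]: a is power majorized by b. The notion only concerns
   positive tuples, so positivity is part of the relation. *)
Definition power_majorized (R : realType) (m : nat) (a b : m.-tuple R) : Prop :=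
  [/\ forall i : 'I_m, 0 < tnth a i,
      forall i : 'I_m, 0 < tnth b i,
      forall p : R, 1 <= p ->
        \sum_(i < m) tnth a i `^ p <= \sum_(i < m) tnth b i `^ p &
      forall p : R, 0 < p < 1 ->
        \sum_(i < m) tnth b i `^ p <= \sum_(i < m) tnth a i `^ p].

Definition quad_prod (R : realType) (n : nat) (u : n.-tuple R) : {poly R} :=
  \prod_(i < n) ('X^2 - (2 * tnth u i) *: 'X + 1).

(* For nonzero f: f splits over R, and x lists all its roots with multiplicity,
   in some order. *)
Definition root_vector (R : realType) (m : nat) (f : {poly R})
    (x : m.-tuple R) : Prop :=
  f = lead_coef f *: \prod_(i < m) ('X - (tnth x i)%:P).

(* Main.v *)
Require Import Defs.
From HB Require Import structures.
From mathcomp Require Import all_boot all_order all_algebra.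
From mathcomp Require Import reals exp.
From mathcomp Require Import ring lra.
From mathcomp Require Import normedtype sequences derive realfun.
Import numFieldNormedType.Exports.

Set Implicit Arguments.
Unset Strict Implicit.
Unset Printing Implicit Defensive.

Import Order.TTheory GRing.Theory Num.Theory.
Local Open Scope ring_scope.

(** For [w >= 1] the roots of [t^2 - 2 w t + 1] are [e^a] and [e^-a], where
    [a = arcosh w]. The sum of the [p]-th powers of all the roots of
    [quad_prod u] is therefore [2 \sum_i g_p (u_i)], where
    [g_p w = cosh (p arcosh w)] ([sum_powR_roots]), and by Karamata's inequality
    ([karamata]) it suffices that [g_p] is convex on [[1, +oo[] for [p >= 1] and
    concave there for [0 < p < 1].

    Convexity is used in the form of a supporting line at each point. In the
    variable [a] this is the inequality [cosh_tangent],
      [cosh (p a) - cosh (p b) >= p r (cosh a - cosh b)],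
    where [r = sinh (p b) / sinh b], or [r = p] when [b = 0]. The difference of
    its two sides vanishes at [a = b], and its derivative in [a] is
    [p (sinh (p a) - r sinh a)], which changes sign at [b] because
    [sinh (p a) / sinh a] is nondecreasing for [p >= 1] ([sinhM_ratio]).

    For [p < 1], exchanging the roles of [a] and [p a] turns the inequality
    for the exponent [1 / p] into the reverse inequality for [p]
    ([cosh_tangent_lt1]). *)

(** * Karamata's inequality *)

Lemma ge0_summation_by_parts (R : realDomainType) (n : nat) (c d : nat -> R) :
  (forall i j, (i <= j < n)%N -> c j <= c i) ->
  (forall k, (k < n)%N -> 0 <= \sum_(i < k) d i) ->
  \sum_(i < n) d i = 0 ->
  0 <= \sum_(i < n) c i * d i.
Proof.
case: n => [|n] c_nincr d_ge0 d_sum0; first by rewrite big_ord0.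
(* Since the sums of the [d_i] are nonnegative, lowering their common factor
   from [c_k] to [c_(k+1)] keeps the bound below the weighted sum. *)
have abel k : (k <= n)%N ->
    c k * \sum_(i < k.+1) d i <= \sum_(i < k.+1) c i * d i.
  elim: k => [|k IHk] lekn; first by rewrite !big_ord1.
  rewrite big_ord_recr [leRHS]big_ord_recr /= mulrDr lerD2r.
  apply: le_trans (IHk (ltnW lekn)).
  by rewrite ler_wpM2r ?d_ge0 ?c_nincr// leqnSn ltnS.
by have := abel n (leqnn n); rewrite d_sum0 mulr0.
Qed.

Lemma sum_largestE (R : realType) (m k : nat) (a : m.-tuple R) : (k <= m)%N ->
  sum_largest k a = \sum_(i < k) (sort >=%R a)`_i.
Proof.
move=> lekm; have szk : size (take k (sort >=%R a)) = k.
  by rewrite size_takel// size_sort size_tuple.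
rewrite /sum_largest (big_nth 0) szk big_mkord.
by apply: eq_bigr => i _; rewrite nth_take.
Qed.

Lemma sum_sortE (R : realType) (m : nat) (a : m.-tuple R) (g : R -> R) :
  \sum_(i < m) g (tnth a i) = \sum_(i < m) g (sort >=%R a)`_i.
Proof.
rewrite -(big_tuple _ _ a xpredT g).
rewrite -(perm_big _ (permEl (perm_sort >=%R a))) (big_nth 0) big_mkord.
by rewrite size_sort size_tuple.
Qed.

(** Convexity of [g] on [D] is assumed as the existence of a supporting line
    of slope [c x] at each point [x] of [D]; [D] need not be an interval. *)
Lemma karamata (R : realType) (n : nat) (D : {pred R}) (g c : R -> R)
    (u v : n.-tuple R) :
  {in D &, forall x y, c x * (y - x) <= g y - g x} ->
  (forall i, tnth u i \in D) -> (forall i, tnth v i \in D) ->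
  majorized v u ->
  \sum_(i < n) g (tnth v i) <= \sum_(i < n) g (tnth u i).
Proof.
move=> tangent uD vD [le_largest eq_sum].
(* The supporting lines at [x] and [y] both bound the chord between them. *)
have c_ndecr : {in D &, {homo c : x y / x <= y}}.
  move=> x y xD yD; rewrite le_eqVlt => /predU1P[->//|ltxy].
  have := tangent _ _ xD yD; have := tangent _ _ yD xD.
  rewrite -[x - y]opprB mulrN -[g x - g y]opprB lerN2 => /[swap].
  by move=> /le_trans/[apply]; rewrite ler_pM2r// subr_gt0.
have sortD (a : n.-tuple R) : (forall i, tnth a i \in D) ->
    forall i, (i < n)%N -> (sort >=%R a)`_i \in D.
  move=> aD i ltin; have : (sort >=%R a)`_i \in (a : seq R).
    by rewrite -(mem_sort >=%R) mem_nth// size_sort size_tuple.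
  by case/tnthP => j ->.
have {uD}uD := sortD u uD; have {vD}vD := sortD v vD.
rewrite (sum_sortE u) (sum_sortE v) -subr_ge0 -sumrB.
set s := sort _ u in uD *; set t := sort _ v in vD *.
apply: le_trans (_ : 0 <= \sum_(i < n) c t`_i * (s`_i - t`_i)) _; last first.
  by apply: ler_sum => i _; apply: tangent; [exact: vD|exact: uD].
have sum_diff k : \sum_(i < k) (s`_i - t`_i) =
    \sum_(i < k) s`_i - \sum_(i < k) t`_i by rewrite sumrB.
apply: (@ge0_summation_by_parts _ n (fun i => c t`_i) (fun i => s`_i - t`_i)).
- move=> i j /andP[leij ltjn]; apply: c_ndecr; rewrite ?vD//.
    exact: leq_ltn_trans ltjn.
  apply: (sorted_leq_nth ge_trans ge_refl) => //.
  + by apply: sort_sorted => x y; rewrite orbC le_total.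
  + by rewrite inE size_sort size_tuple (leq_ltn_trans leij).
  + by rewrite inE size_sort size_tuple.
- move=> k ltkn; rewrite sum_diff subr_ge0.
  have [->|k_gt0] := posnP k; first by rewrite !big_ord0.
  rewrite -!sum_largestE ?(ltnW ltkn)//; apply: le_largest.
  by rewrite k_gt0 -ltnS (ltn_predK ltkn).
- rewrite sum_diff.
  have := eq_sum; rewrite (sum_sortE u id) (sum_sortE v id) => ->.
  by rewrite subrr.
Qed.

(** * Hyperbolic functions *)

Lemma derive_ge0_le (R : realType) (f df : R -> R) (a b : R) : a <= b ->
  (forall x, a <= x <= b -> is_derive x 1 f (df x)) ->
  (forall x, a <= x <= b -> 0 <= df x) -> f a <= f b.
Proof.
move=> leab f_df df_ge0.
have [||c] := @MVT_segment R f df a b leab.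
- move=> x xab; apply: f_df; have := xab; rewrite in_itv /= => /andP[ax xb].
  by rewrite !ltW.
- apply: derivable_within_continuous => x; rewrite in_itv /= => xab.
  by have [] := f_df x xab.
rewrite in_itv /= => cab /eqP; rewrite -subr_ge0 => /eqP ->.
by rewrite mulr_ge0 ?df_ge0// subr_ge0.
Qed.

Section Hyperbolic.
Variable R : realType.
Implicit Types a b p w x : R.

(** Hyperbolic cosine and sine, defined from the exponential. *)
Definition cosh x : R := (expR x + expR (- x)) / 2.
Definition sinh x : R := (expR x - expR (- x)) / 2.

Lemma sinh0 : sinh 0 = 0.
Proof. by rewrite /sinh oppr0 subrr mul0r. Qed.

Lemma sinh_gt0 x : 0 < x -> 0 < sinh x.
Proof. by move=> x0; rewrite divr_gt0// subr_gt0 ltr_expR; lra. Qed.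

Lemma sinh_ge0 x : 0 <= x -> 0 <= sinh x.
Proof. by move=> x0; rewrite divr_ge0// subr_ge0 ler_expR; lra. Qed.

Lemma is_derive_coshM p x :
  is_derive x 1 (fun y => cosh (p * y)) (p * sinh (p * x)).
Proof.
by rewrite /cosh /sinh; apply: is_derive_eq; rewrite /GRing.scale /=; ring.
Qed.

Lemma is_derive_sinhM p x :
  is_derive x 1 (fun y => sinh (p * y)) (p * cosh (p * x)).
Proof.
by rewrite /cosh /sinh; apply: is_derive_eq; rewrite /GRing.scale /=; ring.
Qed.

Lemma is_derive_cosh x : is_derive x 1 cosh (sinh x).
Proof.
by rewrite /cosh /sinh; apply: is_derive_eq; rewrite /GRing.scale /=; ring.
Qed.

Lemma is_derive_sinh x : is_derive x 1 sinh (cosh x).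
Proof.
by rewrite /cosh /sinh; apply: is_derive_eq; rewrite /GRing.scale /=; ring.
Qed.

#[local] Existing Instances is_derive_coshM is_derive_sinhM.
#[local] Existing Instances is_derive_cosh is_derive_sinh.

Lemma ler_cosh a b : 0 <= a -> a <= b -> cosh a <= cosh b.
Proof.
move=> a0 /derive_ge0_le; apply=> x /andP[ax _].
by rewrite sinh_ge0// (le_trans a0).
Qed.

Lemma sinhM_ge p a : 1 <= p -> 0 <= a -> p * sinh a <= sinh (p * a).
Proof.
move=> p1 a0; rewrite -subr_ge0.
have -> : 0 = sinh (p * 0) - p * sinh 0 by rewrite mulr0 sinh0 mulr0 subrr.
apply: (@derive_ge0_le _ (fun x => sinh (p * x) - p * sinh x)
  (fun x => p * (cosh (p * x) - cosh x)) 0 a a0) => x /andP[x0 _].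
  by apply: is_derive_eq; rewrite /GRing.scale /=; ring.
rewrite mulr_ge0 ?subr_ge0 ?ler_cosh//; first lra.
by rewrite ler_peMl.
Qed.

(** That is, [coth a <= p coth (p a)]: up to a positive factor, the difference
    of the two sides is the derivative of [sinh (p a) / sinh a]. *)
Lemma sinhM_coth p a : 1 <= p -> 0 <= a ->
  sinh (p * a) * cosh a <= p * cosh (p * a) * sinh a.
Proof.
move=> p1 a0; rewrite -subr_ge0.
have -> : 0 = p * cosh (p * 0) * sinh 0 - sinh (p * 0) * cosh 0.
  by rewrite mulr0 sinh0 mulr0 mul0r subrr.
apply: (@derive_ge0_le _
  (fun x => p * cosh (p * x) * sinh x - sinh (p * x) * cosh x)
  (fun x => (p ^+ 2 - 1) * (sinh (p * x) * sinh x)) 0 a a0) => x /andP[x0 _].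
  by apply: is_derive_eq; rewrite /GRing.scale /=; ring.
have p0 := le_trans ler01 p1.
have px0 : 0 <= p * x by rewrite mulr_ge0.
by rewrite mulr_ge0 ?subr_ge0 ?expr_ge1// mulr_ge0 ?sinh_ge0.
Qed.

(** The ratio [sinh (p x) / sinh x] is nondecreasing; clearing the denominators
    includes the point [0]. *)
Lemma sinhM_ratio p a b : 1 <= p -> 0 <= b <= a ->
  sinh (p * b) * sinh a <= sinh (p * a) * sinh b.
Proof.
move=> p1 /andP[b0 leba].
have [->|b_neq0] := eqVneq b 0; first by rewrite !mulr0 !sinh0 mul0r mulr0.
have b_gt0 : 0 < b by rewrite lt0r b_neq0.
have sb_gt0 := sinh_gt0 b_gt0.
have sa_gt0 := sinh_gt0 (lt_le_trans b_gt0 leba).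
rewrite -ler_pdivlMr// mulrAC -ler_pdivrMr//.
apply: (@derive_ge0_le _ (fun x => sinh (p * x) / sinh x)
  (fun x => (p * cosh (p * x) * sinh x - sinh (p * x) * cosh x) / sinh x ^+ 2)
  b a leba) => x /andP[bx _]; have x_gt0 := lt_le_trans b_gt0 bx.
  have sx_neq0 : sinh x != 0 by rewrite gt_eqF ?sinh_gt0.
  have inv_derive := is_deriveV sx_neq0 (is_derive_sinh x).
  by apply: is_derive_eq; rewrite /GRing.scale /=; field.
by rewrite divr_ge0 ?sqr_ge0// subr_ge0 sinhM_coth// ltW.
Qed.

(** The continuous extension to [0] of [sinh (p b) / sinh b], as a function of
    [b]. *)
Definition sinh_ratio p b : R := if b == 0 then p else sinh (p * b) / sinh b.

Lemma sinh_ratio_gt0 p b : 0 < p -> 0 <= b -> 0 < sinh_ratio p b.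
Proof.
rewrite /sinh_ratio => p0; case: ifPn => // bN0 b0.
have b_gt0 : 0 < b by rewrite lt0r bN0.
by rewrite divr_gt0 ?sinh_gt0 ?mulr_gt0.
Qed.

Lemma sinh_ratio_le p a b : 1 <= p -> 0 <= b <= a ->
  sinh_ratio p b * sinh a <= sinh (p * a).
Proof.
move=> p1 /andP[b0 leba]; rewrite /sinh_ratio; case: ifPn => [_|bN0].
  by rewrite sinhM_ge// (le_trans b0).
rewrite mulrAC ler_pdivrMr ?sinh_gt0 ?lt0r ?bN0//.
by rewrite sinhM_ratio// b0.
Qed.

Lemma sinh_ratio_ge p a b : 1 <= p -> 0 <= a <= b ->
  sinh (p * a) <= sinh_ratio p b * sinh a.
Proof.
move=> p1 /andP[a0 leab]; rewrite /sinh_ratio; case: ifPn => [/eqP b0|bN0].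
  by have -> : a = 0; [lra|rewrite mulr0 sinh0 mulr0].
rewrite mulrAC ler_pdivlMr ?sinh_gt0 ?lt0r ?bN0 ?(le_trans a0)//.
by rewrite sinhM_ratio// a0.
Qed.

(** The graph of [w |-> cosh (p arcosh w)], for [p >= 1], lies above its tangent
    at [w = cosh b]. *)
Lemma cosh_tangent p a b : 1 <= p -> 0 <= a -> 0 <= b ->
  p * sinh_ratio p b * (cosh a - cosh b) <= cosh (p * a) - cosh (p * b).
Proof.
move=> p1 a0 b0; set c := sinh_ratio p b.
pose h x := cosh (p * x) - p * c * cosh x.
pose dh x := p * (sinh (p * x) - c * sinh x).
have dhP x : is_derive x 1 h (dh x).
  by apply: is_derive_eq; rewrite /dh /GRing.scale /=; ring.
suff: h b <= h a by rewrite /h; lra.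
have p0 := le_trans ler01 p1.
have [leba|/ltW leab] := leP b a.
  apply: (@derive_ge0_le _ h dh _ _ leba) => x /andP[bx _].
  by rewrite /dh mulr_ge0// subr_ge0 sinh_ratio_le// b0.
rewrite -lerN2.
apply: (@derive_ge0_le _ (fun x => - h x) (fun x => - dh x) _ _ leab)
  => x /andP[ax xb].
rewrite /= /dh -mulrN opprB.
rewrite mulr_ge0// subr_ge0 sinh_ratio_ge//.
by rewrite xb (le_trans a0).
Qed.

(** The same graph, for [0 < p < 1], lies below its tangent at [w = cosh b]. *)
Lemma cosh_tangent_lt1 p a b : 0 < p < 1 -> 0 <= a -> 0 <= b ->
  cosh (p * a) - cosh (p * b) <=
    p / sinh_ratio p^-1 (p * b) * (cosh a - cosh b).
Proof.
move=> /andP[p0 p1] a0 b0; set r := sinh_ratio _ _.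
have q1 : 1 <= p^-1 by rewrite invf_ge1// ltW.
have r0 : 0 < r by rewrite sinh_ratio_gt0 ?invr_gt0// mulr_ge0// ltW.
have := cosh_tangent q1 (mulr_ge0 (ltW p0) a0) (mulr_ge0 (ltW p0) b0).
(* Exponent [p^-1] at the points [p a] and [p b]: here [p^-1 (p a) = a]. *)
rewrite !mulKf ?gt_eqF// -/r => tangent.
have -> : cosh (p * a) - cosh (p * b) =
    p / r * (p^-1 * r * (cosh (p * a) - cosh (p * b))).
  by field; rewrite !gt_eqF.
by rewrite ler_pM2l// divr_gt0.
Qed.

(** The nonnegative inverse of [cosh], meaningful for [w >= 1]. *)
Definition arcosh w : R := ln (w + Num.sqrt (w ^+ 2 - 1)).

Lemma arcosh_ge0 w : 1 <= w -> 0 <= arcosh w.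
Proof. by move=> w1; rewrite ln_ge0// ler_wpDr ?sqrtr_ge0. Qed.

Lemma arcoshK w : 1 <= w -> cosh (arcosh w) = w.
Proof.
move=> w1; have s0 := sqrtr_ge0 (w ^+ 2 - 1).
have sE : Num.sqrt (w ^+ 2 - 1) ^+ 2 = w ^+ 2 - 1.
  by rewrite sqr_sqrtr// subr_ge0 expr_ge1// (le_trans ler01).
rewrite /cosh /arcosh expRN lnK ?posrE; last by lra.
by field: sE; lra.
Qed.

End Hyperbolic.

(** * Roots of the quadratic products *)

Section Roots.
Variable R : realType.

(** The roots, with multiplicity, of the product of the [t^2 - 2 w t + 1] for
    [w] in [s], all [w >= 1]. *)
Definition quad_roots (s : seq R) : seq R :=
  [seq expR (arcosh w) | w <- s] ++ [seq expR (- arcosh w) | w <- s].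

Lemma quad_prodE (n : nat) (u : n.-tuple R) : (forall i, 1 <= tnth u i) ->
  quad_prod u = \prod_(z <- quad_roots u) ('X - z%:P).
Proof.
move=> u1; rewrite /quad_prod /quad_roots big_cat /= !big_map -big_split /=.
rewrite big_tuple; apply: eq_bigr => i _.
rewrite -[X in 2 * X](arcoshK (u1 i)) /cosh mulrC divfK ?pnatr_eq0//.
set a := arcosh _.
have : (expR a)%:P * (expR (- a))%:P = 1 :> {poly R}.
  by rewrite -polyCM -expRD subrr expR0.
rewrite -mul_polyC polyCD => ab; ring: ab.
Qed.

Lemma root_vector_perm (n : nat) (u : n.-tuple R) (x : (2 * n).-tuple R) :
  (forall i, 1 <= tnth u i) -> root_vector (quad_prod u) x ->
  perm_eq x (quad_roots u).
Proof.
move=> u1; rewrite /root_vector (quad_prodE u1).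
rewrite (monicP (monic_prod_XsubC _ _ _)) scale1r => eq_prod.
by apply: prod_XsubC_eq; rewrite eq_prod big_tuple.
Qed.

Lemma root_vector_gt0 (n : nat) (u : n.-tuple R) (x : (2 * n).-tuple R) :
  (forall i, 1 <= tnth u i) -> root_vector (quad_prod u) x ->
  forall i, 0 < tnth x i.
Proof.
move=> u1 /(root_vector_perm u1) /perm_mem eqx i.
have := mem_tnth i x; rewrite eqx mem_cat.
by move=> /orP[] /mapP[w _ ->]; rewrite expR_gt0.
Qed.

Lemma sum_powR_roots (n : nat) (u : n.-tuple R) (x : (2 * n).-tuple R) (p : R) :
  (forall i, 1 <= tnth u i) -> root_vector (quad_prod u) x ->
  \sum_(i < 2 * n) tnth x i `^ p =
    2 * \sum_(i < n) cosh (p * arcosh (tnth u i)).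
Proof.
move=> u1 /(root_vector_perm u1) perm_x.
rewrite -(big_tuple _ _ x xpredT (fun z => z `^ p)) (perm_big _ perm_x) /=.
rewrite big_cat /= !big_map -big_split /= mulr_sumr big_tuple.
apply: eq_bigr => i _; rewrite -!expRM mulNr /cosh [p * _]mulrC.
by rewrite [RHS]mulrC divfK ?pnatr_eq0.
Qed.

End Roots.

Theorem theorem2p1 (R : realType) (n : nat) (hn : (1 <= n)%N)
  (u v : n.-tuple R)
  (hu : forall i : 'I_n, 1 <= tnth u i)
  (hv : forall i : 'I_n, 1 <= tnth v i)
  (x y : (2 * n).-tuple R)
  (hx : root_vector (quad_prod u) x)
  (hy : root_vector (quad_prod v) y) :
  majorized v u -> power_majorized y x.
Proof.
move=> maj; split; try exact: root_vector_gt0 hx; try exact: root_vector_gt0 hy.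
- move=> p p1; rewrite (sum_powR_roots p hu hx) (sum_powR_roots p hv hy).
  rewrite ler_pM2l//.
  pose c w := p * sinh_ratio p (arcosh w).
  apply: (@karamata _ _ [pred w | 1 <= w]
    (fun w => cosh (p * arcosh w)) c) => //.
  move=> w z; rewrite !inE => w1 z1.
  rewrite -[in z - w](arcoshK z1) -[in _ - w](arcoshK w1).
  by rewrite cosh_tangent ?arcosh_ge0.
- move=> p p01; rewrite (sum_powR_roots p hu hx) (sum_powR_roots p hv hy).
  (* Concavity: the convex function is [- g_p]. *)
  rewrite ler_pM2l// -lerN2 -!sumrN.
  pose c w := - (p / sinh_ratio p^-1 (p * arcosh w)).
  apply: (@karamata _ _ [pred w | 1 <= w]
    (fun w => - cosh (p * arcosh w)) c) => //.
  move=> w z; rewrite !inE => w1 z1.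
  rewrite -[in z - w](arcoshK z1) -[in _ - w](arcoshK w1).
  by rewrite /c mulNr -opprD lerN2 cosh_tangent_lt1 ?arcosh_ge0.
Qed.
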